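(* Let $\mathcal T$ be a minimally complete abstract Newton tree at infinity. If $(u,e),(u',e')\in P(\mathcal T)$ satisfy $(u,e)\succeq(u',e')$, then the following hold. (a) $\mathcal N(u,e)\supseteq\mathcal N(u',e')$. (b) $c(u,e)\le c(u',e')$ and $\eta(u,e)\ge\eta(u',e')$. (c) $\widetilde\Delta\big(\mathcal N(u,e)\big)-\widetilde\Delta\big(\mathcal N(u',e')\big)=[c(u',e')-c(u,e)]+[\eta(u,e)-\eta(u',e')]$. (d) $\widetilde\Delta\big(\mathcal N(u,e)\big)\ge\widetilde\Delta\big(\mathcal N(u',e')\big)$, where equality holds if and only if $c(u,e)=c(u',e')$ and $\eta(u,e)=\eta(u',e')$.
   Context: **Decorated rooted trees.** A rooted tree is a finite tree with set of cells $X_0$, edges (2-element subsets of $X_0$) and a root $v_0\in X_0$; $\delta_x$ is the valency of $x$, and $\gamma_{x,y}$ the unique path from $x$ to $y$. Arrows: $\mathcal A=\{x:\delta_x=1\}\setminus\{v_0\}$; vertices: $\mathcal V=X_0\setminus\mathcal A$. For distinct $x,y$, $x<y$ means that $x$ is on $\gamma_{v_0,y}$. In a decorated rooted tree, each arrow is decorated by $(0)$ or $(1)$ ($\mathcal A_0$ = set of arrows decorated by $(0)$), and each pair $(e,x)$ with $e$ an edge and $x\in e$ carries an integer $q(e,x)$ (decoration of $e$ near $x$). $Q(e,x)=\prod q(e',x)$ over edges $e'\ne e$ incident to $x$ (empty products are $1$). For an edge $e=\{x,y\}$ with $x,y\in\mathcal V$, $\det(e)=q(e,x)q(e,y)-Q(e,x)Q(e,y)$.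 A dead end is an edge incident to an element of $\mathcal A_0$. **Abstract Newton tree at infinity**: a decorated rooted tree such that (1) for each $v\in\mathcal V$ some $\alpha\in\mathcal A\setminus\mathcal A_0$ satisfies $\alpha>v$; (2) at most one dead end is incident to a given vertex; (3) $q(e,v_0)=1$ for all edges $e$ incident to $v_0$; (4) $q(e,\alpha)=1$ for every edge $e$ incident to an arrow $\alpha$; (5) for $v\in\mathcal V$ and distinct edges $e,e'$ incident to $v$, $q(e,v)$ and $q(e',v)$ are coprime; with $E_v^+$ the set of edges $\{v,x\}$ with $v<x$, $q(e,v)\ge1$ for all $e\in E_v^+$, at most one $e\in E_v^+$ has $q(e,v)>1$, and if a dead end $\epsilon$ is incident to $v$ then $q(\epsilon,v)=\max_{e\in E_v^+}q(e,v)$; (6) $\det(e)<0$ for every edge $e$ joining two vertices. For $v\in\mathcal V$, $\alpha\in\mathcal A\setminus\mathcal A_0$: $x_{v,\alpha}$ is the product of $q(\epsilon,u)$ over all edges $\epsilon$ not in $\gamma_{v,\alpha}$ but incident to a cell $u$ of $\gamma_{v,\alpha}$; $N_v=\sum_{\alpha\in\mathcal A\setminus\mathcal A_0}x_{v,\alpha}$. A dicritical vertex is a vertex with $N_v=0$. The tree is **minimally complete** if (i) $N_v\ge0$ for all $v\in\mathcal V$ and each arrow decorated by $(1)$ is adjacent to a dicritical vertex; (ii) a dead end is incident to each dicritical vertex; (iii) if a dead end $e$ incident to a vertex $v$ has $q(e,v)=1$ then $v$ is dicritical; (iv) every vertex $\ne v_0$ has valency $\ne2$. **Notation.** $\mathcal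 N=\{v\in\mathcal V:N_v>0\}$ (a subtree containing $v_0$; an edge of $\mathcal N$ is an edge with both endpoints in $\mathcal N$). $\mathcal D_v$: set of dicritical vertices adjacent to $v$. Degree $d_u$ of a dicritical $u$: number of $(1)$-arrows adjacent to $u$. $v\in\mathcal N$ is a node if $\mathcal D_v\neq\emptyset$. $a_v=q(e,v)$ if a dead end $e$ is incident to $v$, $a_v=1$ otherwise. $r_v=-1+$ (number of vertices adjacent to $v$). $\epsilon(v)$: number of elements of $\mathcal N$ adjacent to $v$. For $v\in\mathcal N$: $\widetilde\Delta(v)=(r_v-1)(N_v-1)+N_v(1-\frac1{a_v})-\sum_{u\in\mathcal D_v}(d_u-1)$, and $\widetilde\Delta(S)=\sum_{v\in S}\widetilde\Delta(v)$ for $S\subseteq\mathcal N$. $d(v)=N_v$ if $v$ is not a node, $d(v)=\gcd\{d_u:u\in\mathcal D_v\}$ if $v$ is a node. **Characteristic numbers.** $P(\mathcal T)$ is the set of pairs $(u,e)$ with $u\in\mathcal N$ and $e$ an edge of $\mathcal N$ incident to $u$; it is partially ordered by: $(u',e')\prec(u,e)$ iff $\gamma_{u',u}$ contains $e$ but not $e'$. Let $(u,e)\in P(\mathcal T)$, $e=\{u,u_0\}$. If $\epsilon(u_0)=1$, $c(u,e)=d(u_0)/a_{u_0}$. Otherwise, with $u,u_1,\dots,u_n$ the elements of $\mathcal N$ adjacent to $u_0$ and $e_i=\{u_0,u_i\}$, $c(u,e)=\gcd(d(u_0),c(u_0,e_1),\dots,c(u_0,e_n))/a_{u_0}$, where the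 gcd of rationals is the nonnegative generator of the $\mathbb Z$-module they generate. $\mathcal N(u,e)=\{x\in\mathcal N: e\text{ is in }\gamma_{u,x}\}$ and $\eta(u,e)=\widetilde\Delta(\mathcal N(u,e))-(1-c(u,e))$. *)

(* Defs.v *)
From HB Require Import structures.
From mathcomp Require Import all_boot all_order all_algebra.

Set Implicit Arguments.
Unset Strict Implicit.
Unset Printing Implicit Defensive.

Import Order.TTheory GRing.Theory Num.Theory.
Local Open Scope ring_scope.

(* The gcd of a finite family of rationals: the nonnegative generator of the
   Z-submodule of rat spanned by the family. *)
Definition is_ratgcd (s : seq rat) (g : rat) : Prop :=
  0 <= g /\ forall x, inIntSpan (in_tuple s) x <-> exists n : int, x = g *~ n.

Lemma ratgcd2_ex (x y : rat) :
  {g : rat | [/\ 0 <= g, exists k : int, x = g *~ k, exists l : int, y = g *~ l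
             & exists a b : int, g = x *~ a + y *~ b]}.
Proof.
pose D : int := denq x * denq y.
have D_gt0 : 0 < D by rewrite mulr_gt0 ?denq_gt0.
have D_neq0 : D%:~R != 0 :> rat by rewrite intr_eq0 gt_eqF.
pose p := numq x * denq y; pose p' := numq y * denq x.
have Dx : x = p%:~R / D%:~R.
  apply: (mulIf D_neq0); rewrite divfK // /p /D !intrM mulrA; congr (_ * _).
  by rewrite numqE.
have Dy : y = p'%:~R / D%:~R.
  apply: (mulIf D_neq0); rewrite divfK // /p' /D [denq x * _]mulrC !intrM mulrA.
  by rewrite numqE.
have [a [b abE]] := Bezoutz p p'.
exists ((gcdz p p')%:~R / D%:~R); split.
- by rewrite divr_ge0 ?ler0z // ltW.
- exists (p %/ gcdz p p')%Z; rewrite Dx -[RHS]mulrzl mulrA -intrM divzK //.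
  exact: dvdz_gcdl.
- exists (p' %/ gcdz p p')%Z; rewrite Dy -[RHS]mulrzl mulrA -intrM divzK //.
  exact: dvdz_gcdr.
exists a, b; rewrite -abE Dx Dy -(mulrzl _ a) -(mulrzl _ b) intrD !intrM mulrDl.
by rewrite -!mulrA.
Qed.

Lemma inIntSpan_cons (x : rat) (s : seq rat) (y : rat) :
  inIntSpan (in_tuple (x :: s)) y <->
  exists (n : int) (z : rat), inIntSpan (in_tuple s) z /\ y = x *~ n + z.
Proof.
split=> [[a ->] | [n [z [[a ->] ->]]]].
  exists (a ord0), (\sum_(i < size s) s`_i *~ a (lift ord0 i)).
  rewrite big_ord_recl; split=> //.
  by exists [ffun i => a (lift ord0 i)]; apply: eq_bigr => i _; rewrite ffunE.
exists [ffun i => oapp a n (unlift ord0 i)].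
rewrite big_ord_recl ffunE unlift_none; congr (_ + _).
by apply: eq_bigr => i _; rewrite ffunE liftK.
Qed.

Lemma ratgcd_ex (s : seq rat) : {g : rat | is_ratgcd s g}.
Proof.
elim: s => [|x s [g [_ gP]]].
  exists 0; split=> // x; split=> [[a ->] | [n ->]].
    by exists 0; rewrite big_ord0.
  by exists [ffun=> 0]; rewrite big_ord0 mul0rz.
have [h [h0 hx hg hxg]] := ratgcd2_ex x g.
exists h; split=> // y; case: hxg => a [b abE]; split.
  case/inIntSpan_cons=> n [z [/gP[m ->] ->]].
  case: hx hg => k -> [l ->]; exists (k * n + l * m).
  by rewrite -!mulrzA mulrzDr.
case=> n ->; apply/inIntSpan_cons; exists (a * n), (g *~ (b * n)); split.
  by apply/gP; exists (b * n).
by rewrite abE mulrzDl !mulrzA.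
Qed.

Definition ratgcd (s : seq rat) : rat := sval (ratgcd_ex s).

Definition graph_adj (X : finType) (E : {set {set X}}) : rel X :=
  fun x y => [set x; y] \in E.

Record decorated_tree := DecoratedTree {
  cell :> finType;
  edges : {set {set cell}};
  root : cell;
  edges_card2 : forall e, e \in edges -> #|e| = 2%N;
  tree_connected : forall x y, connect (graph_adj edges) x y;
  tree_acyclic : forall c, ucycle (graph_adj edges) c -> (size c <= 2)%N;
  (* whether an arrow is decorated by (1); irrelevant on the other cells *)
  arrow1 : pred cell;
  (* q_ e x is the decoration of e near x; irrelevant unless e is an edge
     incident to x *)
  q_ : {set cell} -> cell -> int
}.

Section Trees.
Variable T : decorated_tree.
Implicit Types (x y u v : T) (e : {set T}).
Local Notation E := (edges T).

Definition adj : rel T := graph_adj E.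

Definition simple_path x y (p : seq T) : bool :=
  [&& path adj x p, last x p == y & uniq (x :: p)].

Lemma simple_path_ex x y : exists p, simple_path x y p.
Proof.
have /connectP[p xp ->] := tree_connected x y.
by case/shortenP: xp => p' xp' Up' _; exists p'; apply/and3P; split.
Qed.

(* The cells of gamma_{x,y} are x :: gamma_tail x y, in order. *)
Definition gamma_tail x y : seq T := xchoose (simple_path_ex x y).
Definition gamma x y : seq T := x :: gamma_tail x y.
Definition gamma_edges x y : seq {set T} :=
  pairmap (fun a b => [set a; b]) x (gamma_tail x y).

Definition incident e x : bool := (e \in E) && (x \in e).
Definition valency x : nat := #|[set e | incident e x]|.
Definition below x y : bool := (x != y) && (x \in gamma (root T) y).

Definition arrows : {set T} := [set x | valency x == 1%N] :\ root T.
Definition vertices : {set T} := ~: arrows.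
Definition arrows0 : {set T} := [set x in arrows | ~~ arrow1 x].
Definition arrows1 : {set T} := arrows :\: arrows0.

Definition Q_ e x : int := \prod_(e' | incident e' x && (e' != e)) q_ e' x.

(* For e = {x, y}: q(e,x) q(e,y) - Q(e,x) Q(e,y). *)
Definition edge_det e : int := \prod_(x in e) q_ e x - \prod_(x in e) Q_ e x.

Definition dead_end e : bool := (e \in E) && [exists x in arrows0, x \in e].
Definition dead_ends_at v : {set {set T}} := [set e | dead_end e & v \in e].
Definition Eplus v : {set {set T}} :=
  [set e in E | [exists x, (e == [set v; x]) && below v x]].

Record abstract_newton_tree : Prop := AbstractNewtonTree {
  newton_arrow : forall v, v \in vertices ->
    exists2 alpha, alpha \in arrows1 & below v alpha;
  newton_dead_end : forall v, v \in vertices -> (#|dead_ends_at v| <= 1)%N;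
  newton_root : forall e, incident e (root T) -> q_ e (root T) = 1;
  newton_at_arrow : forall e alpha,
    alpha \in arrows -> incident e alpha -> q_ e alpha = 1;
  newton_coprime : forall v e e', v \in vertices ->
    incident e v -> incident e' v -> e != e' -> coprimez (q_ e v) (q_ e' v);
  newton_Eplus_ge1 : forall v e, v \in vertices -> e \in Eplus v -> 1 <= q_ e v;
  newton_Eplus_gt1 : forall v, v \in vertices ->
    (#|[set e in Eplus v | (1 < q_ e v)%R]| <= 1)%N;
  newton_dead_end_max : forall v eps, v \in vertices -> eps \in dead_ends_at v ->
    (exists2 e, e \in Eplus v & q_ e v = q_ eps v) /\
    (forall e, e \in Eplus v -> q_ e v <= q_ eps v);
  newton_det : forall e, e \in E -> e \subset vertices -> edge_det e < 0
}.

Definition xprod v alpha : int :=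
  \prod_(u in gamma v alpha)
    \prod_(eps | incident eps u && (eps \notin gamma_edges v alpha)) q_ eps u.
Definition N_ v : int := \sum_(alpha in arrows1) xprod v alpha.

Definition dicritical : {set T} := [set v in vertices | N_ v == 0].

Record minimally_complete : Prop := MinimallyComplete {
  mc_N_ge0 : forall v, v \in vertices -> 0 <= N_ v;
  mc_arrow1 : forall alpha, alpha \in arrows1 ->
    exists2 u, u \in dicritical & adj alpha u;
  mc_dicritical : forall u, u \in dicritical -> exists e, e \in dead_ends_at u;
  mc_dead_end : forall v e, v \in vertices -> e \in dead_ends_at v ->
    q_ e v = 1 -> v \in dicritical;
  mc_valency : forall v, v \in vertices -> v != root T -> valency v <> 2%N
}.

Definition NN : {set T} := [set v in vertices | 0 < N_ v].
Definition NNedges : {set {set T}} := [set e in E | e \subset NN].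

Definition dicriticals_at v : {set T} := [set u in dicritical | adj v u].
Definition degree u : nat := #|[set alpha in arrows1 | adj u alpha]|.
Definition node v : bool := (v \in NN) && (dicriticals_at v != set0).
Definition a_ v : int := if [pick e in dead_ends_at v] is Some e then q_ e v else 1.
Definition r_ v : int := -1 + #|[set u in vertices | adj v u]|%:Z.
Definition NNadj v : {set T} := [set x in NN | adj v x].
Definition epsilon v : nat := #|NNadj v|.

Definition Delta v : rat :=
  (r_ v - 1)%:~R * (N_ v - 1)%:~R + (N_ v)%:~R * (1 - 1 / (a_ v)%:~R)
  - \sum_(u in dicriticals_at v) ((degree u)%:R - 1).
Definition DeltaS (S : {set T}) : rat := \sum_(v in S) Delta v.

Definition d_ v : int :=
  if node v then (\big[gcdn/0%N]_(u in dicriticals_at v) degree u)%:Z else N_ v.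

Definition PT : {set T * {set T}} := [set p | (p.2 \in NNedges) && (p.1 \in p.2)].

Definition Plt (p' p : T * {set T}) : bool :=
  (p.2 \in gamma_edges p'.1 p.1) && (p'.2 \notin gamma_edges p'.1 p.1).
Definition Ple (p' p : T * {set T}) : bool := (p' == p) || Plt p' p.

(* The end of the edge e other than u. *)
Definition other_end u e : T := odflt u [pick x in e :\ u].

(* The recursion for c(u,e), with fuel n; see char_numE for the defining
   equation. *)
Fixpoint char_rec (n : nat) u e : rat :=
  if n is n'.+1 then
    let u0 := other_end u e in
    if epsilon u0 == 1%N then (d_ u0)%:~R / (a_ u0)%:~R
    else ratgcd ((d_ u0)%:~R ::
             [seq char_rec n' u0 [set u0; x] | x <- enum (NNadj u0 :\ u)])
           / (a_ u0)%:~R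
  else 0.

Definition c_ (p : T * {set T}) : rat := char_rec #|T| p.1 p.2.

Definition NNpair (p : T * {set T}) : {set T} :=
  [set x in NN | p.2 \in gamma_edges p.1 x].

Definition eta (p : T * {set T}) : rat := DeltaS (NNpair p) - (1 - c_ p).

Lemma adj_sym x y : adj x y = adj y x.
Proof. by rewrite /adj /graph_adj setUC. Qed.

Lemma adj_neq x y : adj x y -> x != y.
Proof. by move/edges_card2; rewrite cards2; case: eqP. Qed.

Lemma gamma_tailP x y : simple_path x y (gamma_tail x y).
Proof. exact: xchooseP. Qed.

Lemma simple_path_uniq x y p p' :
  simple_path x y p -> simple_path x y p' -> p = p'.
Proof.
elim: p x p' => [|b p IHp] x [|b' p'] //.
- move=> /and3P[_ /eqP/= <- _] /and3P[_ /eqP/= lp /andP[+ _]].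
  by rewrite -{1}lp mem_last.
- move=> /and3P[_ /eqP/= lp /andP[+ _]] /and3P[_ /eqP/= xy _].
  by rewrite xy -{1}lp mem_last.
move=> /and3P[/= /andP[xb bp] lp] /andP[xp Up].
move=> /and3P[/= /andP[xb' bp'] lp'] /andP[xp' Up'].
have [eqb | neqb] := eqVneq b b'.
  subst b'; congr (_ :: _); apply: (IHp b); rewrite /simple_path ?bp ?lp //.
  by rewrite bp' lp'.
pose w := p ++ rev (belast b' p').
have bw : path adj b w.
  rewrite cat_path bp (eqP lp) -(eqP lp') rev_path /=.
  by rewrite (eq_path (e' := adj)) // => s t; rewrite adj_sym.
have lw : last b w = b'.
  rewrite last_cat (eqP lp) -(eqP lp').
  by case: {w bw xp' bp' lp' Up'} p' => //= z p'; rewrite rev_cons last_rcons.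
have xw : x \notin b :: w.
  rewrite inE mem_cat negb_or; move: xp; rewrite inE negb_or => /andP[-> xp].
  rewrite (negPf xp) /= mem_rev; apply: contra xp' => /mem_belast.
  by [].
have: last b w = b' by [].
case/shortenP: bw => w' bw' Uw' sw' lw'.
have: ucycle adj (x :: b :: w').
  rewrite /ucycle /cycle /= rcons_path xb bw' lw' /= adj_sym xb' /=.
  have -> : x \notin b :: w'; last exact: Uw'.
  apply: contra xw; rewrite !inE => /orP[->//|/sw' ->]; exact: orbT.
move/tree_acyclic; case: w' {bw' Uw' sw'} lw' => //= eqb.
by rewrite eqb eqxx in neqb.
Qed.

Lemma other_endE u u0 : u != u0 -> other_end u [set u; u0] = u0.
Proof.
move=> neq; rewrite /other_end; case: pickP => [x|/(_ u0)] /=.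
  by rewrite !inE => /andP[/negPf->]; move/eqP.
by rewrite !inE eqxx orbT eq_sym neq.
Qed.

Lemma set2_inj x y z : [set x; y] = [set x; z] -> y = z.
Proof.
move=> eq2; have: y \in [set x; z] by rewrite -eq2 !inE eqxx orbT.
rewrite !inE => /orP[/eqP yx | /eqP//]; subst y.
have: z \in [set x; x] by rewrite eq2 !inE eqxx orbT.
by rewrite !inE orbb => /eqP.
Qed.

Lemma mem_pairmap_set2 x p e z :
  e \in pairmap (fun a b => [set a; b]) x p -> z \in e -> z \in x :: p.
Proof.
elim: p x => //= y p IHp x; rewrite inE => /orP[/eqP-> | /IHp ep ze].
  by rewrite !inE => /orP[->//|->]; rewrite orbT.
by rewrite inE ep // orbT.
Qed.

Lemma gamma_tail_nil x : gamma_tail x x = [::].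
Proof. by apply: simple_path_uniq (gamma_tailP x x) _; rewrite /simple_path /= eqxx. Qed.

Lemma gamma_tail_adj x y : adj x y -> gamma_tail x y = [:: y].
Proof.
move=> xy; apply: simple_path_uniq (gamma_tailP x y) _.
by rewrite /simple_path /= xy eqxx inE adj_neq.
Qed.

Lemma gamma_tail_cons u u0 ui x : adj u u0 -> adj u0 ui -> ui != u ->
  [set u0; ui] \in gamma_edges u0 x -> gamma_tail u x = u0 :: gamma_tail u0 x.
Proof.
move=> uu0 u0ui neq; rewrite /gamma_edges.
have /and3P[] := gamma_tailP u0 x.
case: (gamma_tail u0 x) => [|b p] // path_p last_p Up eip.
have Eb : b = ui.
  move: eip; rewrite /= inE => /orP[/eqP/set2_inj-> // | eip].
  have u0p := mem_pairmap_set2 eip (set21 u0 ui).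
  by move: Up; rewrite /= u0p.
have up : u \notin b :: p.
  apply/negP => up; move: path_p Up.
  have [p1 [p2 Ep]] : exists p1 p2, b :: p = rcons p1 u ++ p2.
    by case/path.splitP: up => p1 p2; exists p1, p2.
  rewrite {1 2}Ep cat_path -cat_cons cat_uniq => /andP[path1 _] /andP[Up1 _].
  have : simple_path u0 u (rcons p1 u) by rewrite /simple_path path1 last_rcons eqxx Up1.
  have s1 : simple_path u0 u [:: u].
    by rewrite /simple_path /= adj_sym uu0 eqxx inE eq_sym (adj_neq uu0).
  move=> s2; move: Ep; rewrite -(simple_path_uniq s1 s2) => -[bu _].
  by rewrite -Eb bu eqxx in neq.
apply: simple_path_uniq (gamma_tailP u x) _.
have uu0p : u \notin u0 :: b :: p by rewrite inE negb_or (adj_neq uu0) up.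
apply/and3P; split=> //; last by rewrite cons_uniq uu0p Up.
by change (adj u u0 && path adj u0 (b :: p)); rewrite uu0 path_p.
Qed.

Lemma NNpair_step u u0 ui : u0 \in NN -> adj u u0 -> adj u0 ui -> ui != u ->
  NNpair (u0, [set u0; ui]) \proper NNpair (u, [set u; u0]).
Proof.
move=> u0N uu0 u0ui neq; apply/properP; split.
  apply/subsetP => x; rewrite !inE /= => /andP[-> eix] /=.
  by rewrite /gamma_edges (gamma_tail_cons uu0 u0ui neq eix) /= mem_head.
exists u0; first by rewrite inE u0N /gamma_edges gamma_tail_adj //= mem_head.
by rewrite inE u0N /gamma_edges gamma_tail_nil.
Qed.

Lemma char_rec_stable n m u u0 :
    (u, [set u; u0]) \in PT ->
    (#|NNpair (u, [set u; u0])| <= n)%N -> (#|NNpair (u, [set u; u0])| <= m)%N ->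
  char_rec n u [set u; u0] = char_rec m u [set u; u0].
Proof.
elim: n m u u0 => [|n IHn] [|m] u u0 //; rewrite inE /= => /andP[].
all: rewrite inE => /andP[uu0 /subsetP sNN] _.
all: have u0N : u0 \in NN by rewrite sNN ?set22.
all: have /card_gt0P : exists z, z \in NNpair (u, [set u; u0])
  by exists u0; rewrite inE u0N /gamma_edges gamma_tail_adj //= mem_head.
all: move=> pos le1 le2.
- by move: le1; rewrite leqNgt pos.
- by move: le2; rewrite leqNgt pos.
rewrite /= other_endE ?adj_neq //; case: ifP => // _; congr (ratgcd (_ :: _) / _).
apply/eq_in_map => x; rewrite mem_enum !inE => /and3P[neq xN u0x].
have /proper_card lt := NNpair_step u0N uu0 u0x neq.
apply: IHn; rewrite -1?ltnS ?(leq_trans lt) //.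
rewrite inE /= set21 andbT inE; apply/andP; split; first exact: u0x.
by apply/subsetP => z /set2P[] ->; rewrite // !inE.
Qed.

Lemma char_numE u u0 : (u, [set u; u0]) \in PT ->
  c_ (u, [set u; u0]) =
    if epsilon u0 == 1%N then (d_ u0)%:~R / (a_ u0)%:~R
    else ratgcd ((d_ u0)%:~R ::
             [seq c_ (u0, [set u0; x]) | x <- enum (NNadj u0 :\ u)])
           / (a_ u0)%:~R.
Proof.
move=> uP; rewrite /c_ (@char_rec_stable _ #|T|.+1) ?max_card //; last exact/leqW/max_card.
have uu0 : adj u u0 by move: uP; rewrite !inE => /andP[/andP[]].
by rewrite /= other_endE ?adj_neq.
Qed.

End Trees.

(* Main.v *)
Require Import Defs.
From mathcomp Require Import all_boot all_order all_algebra ring lra.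

Set Implicit Arguments.
Unset Strict Implicit.
Unset Printing Implicit Defensive.

Import Order.TTheory GRing.Theory Num.Theory.
Local Open Scope ring_scope.

(**
For an edge [u v] of [NN], write [c] for [c_ (u, [set u; v])], [g = c * a_ v],
[N = N_ v], and for every vertex [y] adjacent to [v] and different from [u]
let [x_y] be [c_ (v, [set v; y])] when [N_ y > 0] and the degree of [y] when
[y] is dicritical. Expanding the definition of [Delta v] gives ([eta_step])

  [eta (u, uv) - sum_y eta (v, vy) = sum_y (N - x_y) - (N - g) / a_ v],

where the sum on the left is over the [y] in [NN] only. The rational [g] is
the gcd of the [x_y] (and is [N] when there is no [y]), so if every [x_y]
divides [N], an elementary inequality ([gcd_defect]) and [a_ v >= 1] make the
right-hand side nonnegative. By induction on the part of the tree beyond the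
edge, every [eta] is nonnegative, and then [eta (u, uv)] is at least each
[eta (v, vy)]. Also [c = g / a_ v <= g <= x_y]. These comparisons of two
consecutive edges ([dominated_step]) chain along paths of [NN]
([dominated_chain]), and the remaining assertions are formal consequences.

What has to be proved is thus that [x_y] divides [N_ v]. The sum [N_ v] splits
along the edge [v y] as

  [N_ v = qprod v y * branch v y + q * branch y v],

where [branch v y] collects the arrows beyond [y], [branch y v] those on the
side of [v], and [q] is the decoration of the edge near [v] ([N_edge]). The
invariant carried by the induction is that [c] divides both branch sums of its
edge ([invariant_step]). The sum [branch u v] is an integral combination of the
[branch v y], all divisible by [g]. For [branch v u], the expansion of each
[branch y v] shows that [g] divides [a_ v] times [branch v u] times the product
of the decorations at [v] of the edges to the vertices other than [u] and [y];
since these decorations are pairwise coprime, their cofactors generate the unit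
ideal ([cofactors_ideal]) and [g] divides [a_ v * branch v u].

For a dicritical [y] both branch sums are computed from [N_ y = 0]
([dicritical_branch]). This uses that a dicritical vertex has only one
neighbouring vertex, which follows from the negativity of the edge
determinants: the parent of a vertex always has positive [N_]
([N_parent_gt0]).
*)

(** * Arithmetic *)

(** The cofactors of pairwise coprime integers generate the unit ideal. By
    induction: deleting [x] and applying the case of [A :\ x] to the ideal
    of the [m] with [f x * m] in [I] gives [f x], and the cofactor of [x]
    is coprime to it. *)

Lemma cofactors_ideal (K : finType) (f : K -> int) (I : int -> Prop) (A : {set K}) :
  (forall m n, I m -> I n -> I (m + n)) -> (forall m n, I n -> I (m * n)) ->
  A != set0 -> {in A &, forall x y, x != y -> coprimez (f x) (f y)} ->
  (forall x, x \in A -> I (\prod_(y in A :\ x) f y)) -> I 1.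
Proof.
have [n] := ubnP #|A|; elim: n A I => // n IHn A I; rewrite ltnS => leA ID IM.
case/set0Pn=> x xA copA IA.
have [Ax0 | Ax_neq0] := eqVneq (A :\ x) set0.
  by have := IA x xA; rewrite Ax0 big_set0.
have Ifx : I (f x * 1).
  apply: (IHn (A :\ x) (fun m => I (f x * m))) => //.
  - by move: leA; rewrite (cardsD1 x A) xA.
  - by move=> m p Im Ip; rewrite mulrDr; apply: ID.
  - by move=> m p Ip; rewrite mulrCA; apply: IM.
  - by move=> y z; rewrite !inE => /andP[_ yA] /andP[_ zA]; apply: copA.
  move=> y; rewrite !inE => /andP[yx yA]; have := IA y yA.
  rewrite (big_setD1 x) /=; last by rewrite !inE eq_sym yx.
  by rewrite setDDl setUC -setDDl.
have cop : coprimez (f x) (\prod_(y in A :\ x) f y).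
  apply: (big_ind (fun m => coprimez (f x) m)) => [|m p cm cp|y].
  - by rewrite coprimezE coprimen1.
  - by rewrite coprimezMr cm.
  by rewrite !inE => /andP[yx yA]; apply: copA; rewrite // eq_sym.
case/coprimezP: cop => -[a b] /= <-.
by rewrite mulr1 in Ifx; apply: ID; apply: IM => //; apply: IA.
Qed.

Lemma int_ge1 (y : rat) : 0 < y -> y \is a Num.int -> 1 <= y.
Proof. by move=> y0 /intrP[m Em]; move: y0; rewrite Em ltr0z ler1z. Qed.

(** Here and below, divisibility of a rational [y] by a rational [x] is expressed
    as [y / x \is a Num.int]. *)
Lemma ratdvd_le (x y : rat) : 0 < x -> 0 < y -> y / x \is a Num.int -> x <= y.
Proof.
move=> x0 y0 /int_ge1; rewrite divr_gt0 //.
by rewrite ler_pdivlMr ?mul1r // => /(_ isT).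
Qed.

Lemma ratdvd_trans (x y z : rat) : y != 0 ->
  z / y \is a Num.int -> y / x \is a Num.int -> z / x \is a Num.int.
Proof. by move=> y0 zy yx; rewrite -[z](divfK y0) -[_ * y / x]mulrA rpredM. Qed.

Lemma biggcdn_dvd_int (I : finType) (P : pred I) (F : I -> nat) (z : rat) :
  (forall i, P i -> (F i)%:R / z \is a Num.int) ->
  (\big[gcdn/0%N]_(i | P i) F i)%:R / z \is a Num.int.
Proof.
apply: (big_ind (fun m : nat => m%:R / z \is a Num.int)); first by rewrite mul0r rpred0.
move=> m p mz pz; have [a [b E]] := Bezoutz m p.
have -> : (gcdn m p)%:R = a%:~R * m%:R + b%:~R * p%:R :> rat.
  rewrite -[m%:R]/(m%:Z%:~R) -[p%:R]/(p%:Z%:~R) -!intrM -intrD E.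
  by rewrite /gcdz !absz_nat.
by rewrite mulrDl -!mulrA rpredD // rpredM // rpred_int.
Qed.

Section RatGcd.
Variable s : seq rat.

Lemma ratgcd_ge0 : 0 <= ratgcd s.
Proof. by rewrite /ratgcd; case: (ratgcd_ex s) => g []. Qed.

Lemma ratgcd_dvd x : x \in s -> exists k : int, x = ratgcd s *~ k.
Proof.
rewrite /ratgcd; case: (ratgcd_ex s) => g [_ gP] /= xs; apply/gP.
move: xs => /(nthP 0)[i lt_i <-].
exists [ffun j : 'I_(size s) => (val j == i)%:Z].
rewrite (bigD1 (Ordinal lt_i)) //= ffunE eqxx mulr1z big1 ?addr0 // => j.
by rewrite -val_eqE /= => /negPf ne; rewrite ffunE ne mulr0z.
Qed.

Lemma ratgcd_greatest z : (forall x, x \in s -> x / z \is a Num.int) ->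
  ratgcd s / z \is a Num.int.
Proof.
move=> sz; have [a ->] : inIntSpan (in_tuple s) (ratgcd s).
  by rewrite /ratgcd; case: (ratgcd_ex s) => g [_ gP] /=; apply/gP; exists 1.
rewrite mulr_suml rpred_sum // => i _; rewrite -mulrzl -mulrA rpredM ?rpred_int // sz //.
exact: mem_nth.
Qed.

End RatGcd.

(** The last hypothesis says that [g] is a multiple of each common divisor of [N]
    and the [x k]. If all [x k] equal [N], it makes [g] a multiple of [N];
    if exactly one differs from [N], it makes [g] a multiple of that one; and if two
    of them differ from [N], each is at most [N / 2], so that their two terms
    already add up to [N]. *)
Lemma gcd_defect (K : finType) (A : {set K}) (x : K -> rat) (N g : rat) :
  0 < N -> 0 < g ->
  (forall k, k \in A -> 0 < x k /\ N / x k \is a Num.int) ->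
  (forall z, z != 0 -> N / z \is a Num.int ->
     (forall k, k \in A -> x k / z \is a Num.int) -> g / z \is a Num.int) ->
  N - g <= \sum_(k in A) (N - x k).
Proof.
move=> N0 g0 xA gmax.
have x_le k : k \in A -> 0 <= N - x k.
  by case/xA=> x0 xN; rewrite subr_ge0 ratdvd_le.
have half k : k \in A -> x k != N -> 2 * x k <= N.
  move=> kA neq; case: (xA k kA) => x0 xN.
  have lt1 : 1 < N / x k by rewrite ltr_pdivlMr // mul1r lt_neqAle neq -subr_ge0 x_le.
  rewrite -ler_pdivlMr //; move: xN lt1 => /intrP[m ->].
  by rewrite ltr1z -lez1D -(ler_int rat).
have [k /andP[kA xkN] | allN] := pickP [pred k | (k \in A) && (x k != N)]; last first.
  have xN k : k \in A -> x k = N by move=> kA; have := allN k; rewrite /= kA => /negbFE/eqP.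
  have gN : N <= g.
    apply: ratdvd_le => //; apply: gmax; rewrite ?gt_eqF ?divff ?gt_eqF // => k kA.
    by rewrite xN // divff ?gt_eqF.
  by apply: le_trans (sumr_ge0 _ x_le); rewrite subr_le0.
rewrite (bigD1 k) //=.
have [j /and3P[jA jk xjN] | allN] := pickP [pred j | [&& j \in A, j != k & x j != N]].
  rewrite (bigD1 j) ?jA //=; have := half j jA xjN; have := half k kA xkN.
  have : 0 <= \sum_(i in A | (i != k) && (i != j)) (N - x i).
    by apply: sumr_ge0 => i /andP[/x_le].
  under [X in 0 <= X]eq_bigl => i do rewrite andbA.
  by lra.
have xN j : j \in A -> j != k -> x j = N.
  by move=> jA jk; have := allN j; rewrite /= jA jk => /negbFE/eqP.
rewrite big1 => [|j /andP[jA jk]]; last by rewrite xN // subrr.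
rewrite addr0 lerD2l lerN2; case: (xA k kA) => x0 xkd; apply: ratdvd_le => //.
apply: gmax; rewrite ?gt_eqF // => j jA.
by have [-> | jk] := eqVneq j k; rewrite ?divff ?gt_eqF // xN.
Qed.

(** * Paths and branches of a tree *)

Section Branches.
Variable T : decorated_tree.
Implicit Types (x y z c u v : T) (e : {set T}).
Local Notation adj := (@adj T).

(** The neighbour of [x] in the direction of [c]; it is [x] when [c = x]. *)
Definition toward x c : T := head x (gamma_tail x c).

Lemma gamma_split x y c : y \in gamma x c -> gamma x c = gamma x y ++ gamma_tail y c.
Proof.
rewrite inE => /orP[/eqP->|yxc]; first by rewrite /gamma gamma_tail_nil.
rewrite /gamma cat_cons; congr (_ :: _); have /and3P[] := gamma_tailP x c.
case/path.splitPr: yxc => p1 p2; rewrite cat_path last_cat -cat_cons cat_uniq /=.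
move=> /and3P[xp1 p1y yp2] /eqP lc /and3P[Up1 disj Up2].
have sxy: simple_path x y (rcons p1 y).
  rewrite /simple_path rcons_path xp1 p1y last_rcons eqxx -rcons_cons rcons_uniq /=.
  by rewrite Up1 andbT; move: disj; rewrite negb_or => /andP[].
have syc: simple_path y c p2 by rewrite /simple_path yp2 lc eqxx.
rewrite (simple_path_uniq (gamma_tailP x y) sxy).
by rewrite (simple_path_uniq (gamma_tailP y c) syc) cat_rcons.
Qed.

Lemma gamma_step x y c : adj x y -> y \in gamma x c -> gamma x c = x :: gamma y c.
Proof. by move=> xy /gamma_split->; rewrite /gamma gamma_tail_adj. Qed.

(** Removing an edge leaves two components, so that exactly one of its ends is
    passed on the way from the other end to [c]. *)
Lemma gamma_back x y c : adj x y -> (x \in gamma y c) = (y \notin gamma x c).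
Proof.
move=> xy; apply/idP/idP => [xyc|].
  apply/negP => yxc.
  have /and3P[_ _] := gamma_tailP x c.
  by rewrite -/(gamma x c) (gamma_step xy yxc) cons_uniq xyc.
move=> yxc; suff -> : gamma y c = y :: gamma x c by rewrite !inE eqxx orbT.
congr (_ :: _); apply: simple_path_uniq (gamma_tailP y c) _.
have /and3P[pxc lxc Uxc] := gamma_tailP x c.
apply/and3P; split=> //.
  by apply/andP; split; first by change (adj y x); rewrite adj_sym.
by rewrite cons_uniq yxc.
Qed.

Lemma gamma_extend x y z c : adj x y -> adj y z -> z != x ->
  z \in gamma y c -> y \in gamma x c.
Proof.
move=> xy yz zx zyc; rewrite gamma_back 1?adj_sym //; apply/negP => xyc.
have := gamma_step yz zyc; rewrite (gamma_step (y := x)) 1?adj_sym //.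
by move=> [/eqP]; rewrite eq_sym (negPf zx).
Qed.

Lemma towardP x c : c != x -> adj x (toward x c) /\ toward x c \in gamma x c.
Proof.
rewrite /toward /gamma; have /and3P[] := gamma_tailP x c.
case: (gamma_tail x c) => [_ /eqP/= -> _|y p /andP[xy _] _ _ _]; first by rewrite eqxx.
by split; rewrite // !inE eqxx orbT.
Qed.

Lemma mem_gamma_toward x y c : adj x y ->
  (y \in gamma x c) = (c != x) && (toward x c == y).
Proof.
move=> xy; apply/idP/andP => [yxc | [cx /eqP <-]]; last by case: (towardP cx).
split.
  apply: contraTneq yxc => ->; rewrite /gamma gamma_tail_nil inE eq_sym.
  exact: adj_neq.
by case: (gamma_step xy yxc) => E; rewrite /toward E.
Qed.

Lemma gamma_refl x : gamma x x = [:: x].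
Proof. by rewrite /gamma gamma_tail_nil. Qed.

Lemma gamma_last x c : c \in gamma x c.
Proof.
have /and3P[_ /eqP lc _] := gamma_tailP x c.
by rewrite -[c in c \in _]lc; apply: mem_last.
Qed.

Lemma gamma_edges_step x y c : adj x y -> y \in gamma x c ->
  gamma_edges x c = [set x; y] :: gamma_edges y c.
Proof. by move=> xy /(gamma_step xy)[E]; rewrite /gamma_edges E. Qed.

Lemma gamma_edges_cell x c e z : e \in gamma_edges x c -> z \in e -> z \in gamma x c.
Proof. exact: mem_pairmap_set2. Qed.

Lemma mem_gamma_edges x y c : adj x y ->
  ([set x; y] \in gamma_edges x c) = (y \in gamma x c).
Proof.
move=> xy; apply/idP/idP => [xyc | yxc]; last by rewrite (gamma_edges_step xy) ?mem_head.
by apply: gamma_edges_cell xyc _; rewrite !inE eqxx orbT.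
Qed.

Lemma gamma_sym x y z : (z \in gamma x y) = (z \in gamma y x).
Proof.
have /and3P[pxy /eqP lxy Uxy] := gamma_tailP x y.
suff -> : gamma y x = rev (gamma x y) by rewrite mem_rev.
have E : rev (gamma x y) = y :: rev (belast x (gamma_tail x y)).
  by rewrite /gamma lastI rev_rcons lxy.
rewrite E; congr (_ :: _); apply: simple_path_uniq (gamma_tailP y x) _.
apply/and3P; split.
- rewrite -{1}lxy rev_path; move: pxy.
  by rewrite (eq_path (e' := adj)) // => s t; rewrite adj_sym.
- by rewrite -(last_cons y) -E /gamma rev_cons last_rcons.
by rewrite -E rev_uniq.
Qed.

(** The set of cells beyond an oriented edge shrinks when the edge is followed
    by another one, so that properties of oriented edges can be proved
    starting from the leaves. *)
Lemma oriented_edge_ind (P : T -> T -> Prop) :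
  (forall x y, adj x y -> (forall z, adj y z -> z != x -> P y z) -> P x y) ->
  forall x y, adj x y -> P x y.
Proof.
move=> step x y; have [n] := ubnP #|[set c | y \in gamma x c]|.
elim: n x y => // n IHn x y; rewrite ltnS => lt_n xy; apply: step => // z yz zx.
apply: IHn => //; apply: leq_trans lt_n; apply: proper_card; apply/properP; split.
  by apply/subsetP => c; rewrite !inE; apply: gamma_extend.
by exists y; rewrite inE ?gamma_last // gamma_refl inE eq_sym adj_neq.
Qed.

(** In this form the equivalence reindexes sums over the cells other than [y] beyond
    the oriented edge from [x] to [y] as double sums over the next cell [z] and the
    cells beyond it. *)
Lemma beyondP x y z c : adj x y -> adj y z ->
  ([&& y \in gamma x c, c != y & toward y c == z]) = (z != x) && (z \in gamma y c).
Proof.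
move=> xy yz; rewrite (mem_gamma_toward c yz) andbCA.
case: (eqVneq c y) => [|cy]/=; first by rewrite !andbF.
case: eqP => [nz|]; rewrite ?andbT ?andbF //.
have zyc : z \in gamma y c by rewrite mem_gamma_toward // cy nz eqxx.
apply/idP/idP => [yxc|zx]; last exact: gamma_extend zyc.
by apply: contraTneq zyc => ->; rewrite gamma_back // 1?adj_sym // negbK.
Qed.

(** ** Edges and valency *)

Lemma edge_nbr v e : incident e v -> exists2 z, adj v z & e = [set v; z].
Proof.
case/andP=> eE ve; have := edges_card2 eE => /eqP/cards2P[a [b [ab Ee]]].
move: ve; rewrite Ee !inE => /orP[]/eqP->; last rewrite setUC.
  by exists b; rewrite // /adj /graph_adj -Ee.
by exists a; rewrite // /adj /graph_adj setUC -Ee.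
Qed.

Lemma incident_nbr v z : adj v z -> incident [set v; z] v.
Proof. by move=> vz; rewrite /incident set21 andbT; exact: vz. Qed.

Lemma edge2_inj v z z' : ([set v; z] == [set v; z']) = (z == z').
Proof. by apply/eqP/eqP=> [/set2_inj|->]. Qed.

Lemma valency_nbr v : valency v = #|[set z | adj v z]|.
Proof.
rewrite /valency -(card_imset _ (fun z z' => @set2_inj _ v z z')).
congr #|pred_of_set _|; apply/setP => e; rewrite !inE; apply/idP/imsetP.
  by move/edge_nbr => [z vz ->]; exists z; rewrite // inE.
by case=> z; rewrite inE => vz ->; apply: incident_nbr.
Qed.

Lemma vertexE v : (v \in vertices T) = (v == Defs.root T) || (valency v != 1%N).
Proof. by rewrite !inE negb_and negbK. Qed.

Lemma vertex2 v x y : adj v x -> adj v y -> x != y -> v \in vertices T.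
Proof.
move=> vx vy neq; rewrite vertexE valency_nbr; apply/orP; right.
have: (#|[set x; y]| <= #|[set z | adj v z]|)%N.
  by apply/subset_leq_card/subsetP => z /set2P[]->; rewrite inE.
by rewrite cards2 neq; case: #|_| => [|[]].
Qed.

Lemma arrow_nbr v x y : v \in arrows T -> adj v x -> adj v y -> x = y.
Proof.
by move=> va vx vy; apply: contraTeq va => /(vertex2 vx vy); rewrite inE.
Qed.

Lemma beyond_arrow x y c : y \in arrows T -> adj x y -> (y \in gamma x c) = (c == y).
Proof.
move=> ya xy; apply/idP/eqP => [yxc|->]; last exact: gamma_last.
apply: contraTeq yxc => cy; have [yn nyc] := towardP cy.
have := arrow_nbr (y := x) ya yn; rewrite adj_sym => /(_ xy) E.
by rewrite -gamma_back 1?adj_sym // -E.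
Qed.

(** ** Parents and children *)

Local Notation r := (Defs.root T).

Definition child x y := adj x y && (x \in gamma y r).

Lemma child_adj x y : child x y -> adj x y.
Proof. by case/andP. Qed.

Lemma child_or_parent x y : adj x y -> child x y || child y x.
Proof.
move=> xy; rewrite /child xy adj_sym xy /= [X in _ || X]gamma_back 1?adj_sym //.
exact: orbN.
Qed.

Lemma child_step x y z : child x y -> adj y z -> z != x -> child y z.
Proof.
case/andP=> xy xyr yz zx; rewrite /child yz gamma_back // 1?adj_sym //.
have yx : adj y x by rewrite adj_sym.
move: xyr; rewrite !mem_gamma_toward // => /andP[_ /eqP->].
by rewrite [x == z]eq_sym (negPf zx) andbF.
Qed.

Lemma parent_uniq x x' y : child x y -> child x' y -> x = x'.
Proof.
case/andP=> xy xyr /andP[xy' xyr'].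
have [yx yx'] : adj y x /\ adj y x' by rewrite !(adj_sym y).
by move: xyr xyr'; rewrite !mem_gamma_toward // => /andP[_ /eqP->] /andP[_ /eqP->].
Qed.

(** The path from [c] to the root passes [y] and then [x], so the part of it between
    [c] and [y] does not meet [x]. *)
Lemma parent_not_toward x y c : child x y -> below y c -> x \notin gamma y c.
Proof.
case/andP=> xy xyr /andP[_ yrc]; apply/negP => xyc.
have yx : adj y x by rewrite adj_sym.
have /and3P[_ _] := gamma_tailP c r; rewrite -/(gamma c r) (@gamma_split c y) 1?gamma_sym //.
rewrite cat_uniq => /and3P[_ /hasPn disj _].
have /disj : x \in gamma_tail y r by move: xyr; rewrite inE (negPf (adj_neq xy)).
by rewrite /= gamma_sym xyc.
Qed.

End Branches.

(** * Branch sums *)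

Section BranchSums.
Variable T : decorated_tree.
Implicit Types (x y z c u v w : T) (e : {set T}).
Local Notation adj := (@adj T).

Definition qn v z : int := q_ [set v; z] v.

Definition qprod v z : int := \prod_(w | adj v w && (w != z)) qn v w.

(** The contribution to the numbers [N_] of the (1)-arrows beyond the oriented edge
    from [x] to [y]. The decorations near [x] are left out, so that this number does
    not depend on the arrangement of the tree behind [x]. *)
Definition branch x y : int :=
  \sum_(alpha in arrows1 T | y \in gamma x alpha)
    \prod_(z in gamma y alpha)
      \prod_(e | incident e z && (e \notin gamma_edges x alpha)) q_ e z.

Lemma prod_incident v (P : pred {set T}) :
  \prod_(e | incident e v && P e) q_ e v =
  \prod_(z | adj v z && P [set v; z]) qn v z.
Proof.
rewrite -(big_imset (fun e => q_ e v) (A := [pred z | adj v z && P [set v; z]])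
   (h := fun z => [set v; z])) /=; last by move=> z z' _ _; apply: set2_inj.
apply: eq_bigl => e; apply/idP/imsetP => [/andP[/edge_nbr[z vz ->] Pz]|].
  by exists z; rewrite // inE vz.
by case=> z; rewrite inE => /andP[vz Pz] ->; rewrite incident_nbr.
Qed.

Lemma Q_nbr v z : adj v z -> Q_ [set v; z] v = qprod v z.
Proof.
move=> vz; rewrite /Q_ (prod_incident v (fun e => e != [set v; z])).
by apply: eq_bigl => w; rewrite edge2_inj.
Qed.

Lemma big_mem_cons (F : T -> int) v (s : seq T) : v \notin s ->
  \prod_(w in v :: s) F w = F v * \prod_(w in s) F w.
Proof.
move=> vs; rewrite (bigD1 v) ?mem_head //=; congr (_ * _).
apply: eq_bigl => w; rewrite inE; case: eqP => [->|]; rewrite ?andbF ?andbT //.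
by rewrite (negPf vs).
Qed.

Lemma gamma_notin v z c : adj v z -> z \in gamma v c -> v \notin gamma z c.
Proof. by move=> vz; rewrite -gamma_back // adj_sym. Qed.

Lemma start_edge v z c w : adj v z -> z \in gamma v c ->
  ([set v; w] \in gamma_edges v c) = (w == z).
Proof.
move=> vz zvc; rewrite (gamma_edges_step vz zvc) inE edge2_inj.
case: eqP => //= _; apply: contraNF (gamma_notin vz zvc).
by move/gamma_edges_cell; apply; rewrite set21.
Qed.

Lemma branchE x y : adj x y -> y \notin arrows1 T ->
  branch x y = \sum_(z | adj y z && (z != x))
    (\prod_(w | adj y w && ((w != x) && (w != z))) qn y w) * branch y z.
Proof.
move=> xy y1.
rewrite /branch (partition_big (toward y) (fun z => adj y z && (z != x))) /=; last first.
  move=> c /andP[c1 yxc].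
  have cy : c != y by apply: contraNneq y1 => <-.
  have [yn nyc] := towardP cy; rewrite yn /=.
  have := beyondP c xy yn; rewrite yxc cy eqxx /=.
  by move=> /esym/andP[].
apply: eq_bigr => z /andP[yz zx]; rewrite big_distrr /=.
apply: eq_big => [c|c /andP[/andP[c1 yxc] nc]].
  case c1: (c \in arrows1 T) => //=.
  have cy : c != y by apply: contraNneq y1 => <-; rewrite c1.
  by have := beyondP c xy yz; rewrite cy zx.
have cy : c != y by apply: contraNneq y1 => <-; rewrite c1.
have zyc : z \in gamma y c by rewrite mem_gamma_toward // cy nc.
have ynz := gamma_notin yz zyc; have xny := gamma_notin xy yxc.
rewrite (gamma_step yz zyc) big_mem_cons //; congr (_ * _).
  rewrite (prod_incident y (fun e => e \notin gamma_edges x c)).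
  apply: eq_bigl => w; case yw: (adj y w) => //=.
  rewrite (gamma_edges_step xy yxc) inE (start_edge _ yz zyc).
  by rewrite [[set x; y]]setUC edge2_inj negb_or.
apply: eq_bigr => w wzc; apply: eq_bigl => e.
case ew: (incident e w) => //=.
rewrite (gamma_edges_step xy yxc) inE; case: eqP => // Ee.
move: ew; rewrite Ee => /andP[_ /set2P[] Ew].
  by move: xny; rewrite (gamma_step yz zyc) inE -Ew wzc orbT.
by move: ynz; rewrite -Ew wzc.
Qed.

Lemma N_branch v : v \notin arrows1 T ->
  N_ v = \sum_(z | adj v z) qprod v z * branch v z.
Proof.
move=> v1; rewrite /N_ (partition_big (toward v) (adj v)) /=; last first.
  by move=> c c1; apply: (towardP _).1; apply: contraNneq v1 => <-.
apply: eq_bigr => z vz; rewrite big_distrr /=.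
apply: eq_big => [c|c /andP[c1 nc]].
  case c1: (c \in arrows1 T) => //=; rewrite mem_gamma_toward //.
  suff -> : c != v by [].
  by apply: contraNneq v1 => <-; rewrite c1.
have cv : c != v by apply: contraNneq v1 => <-; rewrite c1.
have zvc : z \in gamma v c by rewrite mem_gamma_toward // cv nc.
have vnz := gamma_notin vz zvc.
rewrite /xprod (gamma_step vz zvc) big_mem_cons //; congr (_ * _).
  rewrite (prod_incident v (fun e => e \notin gamma_edges v c)).
  by apply: eq_bigl => w; rewrite (start_edge _ vz zvc).
Qed.

Lemma branch_arrow x y : y \in arrows T -> adj x y -> branch x y = (y \in arrows1 T)%:R.
Proof.
move=> ya xy.
rewrite /branch; under eq_bigl => c do rewrite beyond_arrow //.
case y1: (y \in arrows1 T); last first.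
  by rewrite big1 // => c /andP[c1 /eqP Ec]; rewrite -Ec c1 in y1.
rewrite (big_pred1 y) => [|c]; last by rewrite /=; case: eqP => [->|]; rewrite ?y1 ?andbF.
rewrite gamma_refl big_mem_cons // [X in _ * X]big_pred0 // mulr1.
rewrite big_pred0 // => e; apply/negP => /andP[/edge_nbr[z yz ->]].
have yx : adj y x by rewrite adj_sym.
by rewrite (arrow_nbr ya yz yx) setUC mem_gamma_edges // gamma_last.
Qed.

(** An arrow beyond [z] contributes the decorations at [v] of the edges other
    than [v z]; for the remaining arrows, the edge [v z] is off the path, which
    yields the factor [qn v z] in front of what they contribute to [branch z v]. *)
Lemma N_edge v z : v \notin arrows1 T -> adj v z ->
  N_ v = qprod v z * branch v z + qn v z * branch z v.
Proof.
move=> v1 vz; rewrite N_branch // (bigD1 z) //=; congr (_ + _).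
rewrite branchE 1?adj_sym // big_distrr /=; apply: eq_bigr => y /andP[vy yz].
rewrite /qprod (bigD1 z) /= ?vz 1?eq_sym // mulrA; congr (_ * _ * _).
by apply: eq_bigl => w; rewrite andbAC andbA.
Qed.

End BranchSums.

(** * Positivity and dicritical vertices of Newton trees *)

Section NewtonTree.
Variable T : decorated_tree.
Hypothesis newtonT : abstract_newton_tree T.
Implicit Types (x y z c u v w : T) (e : {set T}).
Local Notation adj := (@adj T).
Local Notation r := (Defs.root T).

Lemma arrows1P v : v \in arrows1 T -> v \in arrows T.
Proof. by rewrite inE => /andP[]. Qed.

Lemma vertex_notin1 v : v \in vertices T -> v \notin arrows1 T.
Proof. by rewrite inE; apply: contra => /arrows1P. Qed.

Lemma arrow0_notin v : v \in arrows0 T -> v \notin vertices T.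
Proof. by rewrite in_setC negbK inE => /andP[]. Qed.

Lemma cell_cases v : [|| v \in vertices T, v \in arrows0 T | v \in arrows1 T].
Proof. by rewrite !inE; case: (v != r); case: (valency v == 1%N); case: (arrow1 v). Qed.

Lemma child_Eplus v w : child v w -> [set v; w] \in Eplus v.
Proof.
case/andP=> vw vwr; rewrite inE; apply/andP; split; first exact: vw.
by apply/existsP; exists w; rewrite eqxx /below adj_neq //= gamma_sym.
Qed.

Lemma qn_child_ge1 v w : v \in vertices T -> child v w -> 1 <= qn v w.
Proof. by move=> vV /child_Eplus; apply: newton_Eplus_ge1. Qed.

Lemma prod_qn_child_gt0 (P : pred T) v : v \in vertices T ->
  (forall w, adj v w -> P w -> child v w) -> 0 < \prod_(w | adj v w && P w) qn v w.
Proof.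
move=> vV cvP; apply: prodr_gt0 => w /andP[vw Pw].
by apply: lt_le_trans (qn_child_ge1 vV _); rewrite ?cvP.
Qed.

(** Away from the root only decorations in [Eplus] occur, and these are positive;
    strict positivity comes from the (1)-arrow lying beyond each vertex. *)
Lemma branch_child x y : child x y ->
  0 <= branch x y /\ (y \notin arrows0 T -> 0 < branch x y).
Proof.
move=> cxy; have xy := child_adj cxy; move: x y xy cxy.
apply: oriented_edge_ind => x y xy IH cxy.
have [ya | ya] := boolP (y \in arrows T).
  rewrite branch_arrow // ler0n; split=> // y0.
  by rewrite ltr0n lt0b inE y0.
have yV : y \in vertices T by rewrite inE.
have y1 := vertex_notin1 yV.
have ch z : adj y z && (z != x) -> child y z by case/andP; apply: child_step.
have coef z : 0 < \prod_(w | adj y w && ((w != x) && (w != z))) qn y w.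
  by apply: prod_qn_child_gt0 => // w yw /andP[wx _]; rewrite ch ?yw.
have brz z : adj y z && (z != x) -> 0 <= branch y z.
  by move=> yz; case: (IH z _ _ (ch z yz)); case/andP: yz.
suff lt0 : 0 < branch x y by rewrite ltW.
have [c c1 yc] := newton_arrow newtonT yV.
have cy : c != y by apply: contraNneq y1 => <-.
have [yz zyc] := towardP cy; set z := toward y c in yz zyc.
have zx : z != x.
  by apply: contraTneq zyc => ->; apply: parent_not_toward cxy yc.
have z0 : z \notin arrows0 T.
  apply: contraL c1; rewrite inE => /andP[za z1].
  by move: zyc; rewrite beyond_arrow // => /eqP ->; rewrite !inE z1 andbT andNb.
rewrite branchE // (bigD1 z) ?yz //=; apply: ltr_wpDr.
  apply: sumr_ge0 => w /andP[yw _]; apply: mulr_ge0; [exact: ltW | exact: brz].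
by apply: mulr_gt0 => //; apply: (IH z yz zx (ch z _)).2; rewrite ?yz.
Qed.

Lemma qprod_parent_gt0 v w : w \in vertices T -> child v w -> 0 < qprod w v.
Proof. by move=> wV cvw; apply: prod_qn_child_gt0 => // z wz zv; apply: child_step cvw _ _. Qed.

(** Eliminating [branch w v] between the expressions of [N_ v] and [N_ w] along the
    edge, the coefficient of the positive [branch v w] becomes the opposite of
    the determinant of the edge. *)
Lemma N_parent_gt0 v w : v \in vertices T -> w \in vertices T -> child v w ->
  0 <= N_ w -> 0 < N_ v.
Proof.
move=> vV wV cvw Nw; have vw := child_adj cvw; have wv : adj w v by rewrite adj_sym.
have A0 : 0 < branch v w by apply: (branch_child cvw).2; rewrite inE negb_and -in_setC wV.
have Q0 := qprod_parent_gt0 wV cvw; have q1 := qn_child_ge1 vV cvw.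
have det : qn v w * qn w v - qprod v w * qprod w v < 0.
  have := newton_det newtonT (e := [set v; w]) vw.
  have nvw : v \notin [set w] by rewrite inE adj_neq.
  rewrite /edge_det !big_setU1 //= !big_set1 Q_nbr // [in Q_ _ w]setUC Q_nbr //.
  rewrite /qn [[set w; v]]setUC; apply; apply/subsetP => z.
  by rewrite !inE => /orP[]/eqP->; move: vV wV; rewrite !inE.
have EN : qprod w v * N_ v =
    qn v w * N_ w - (qn v w * qn w v - qprod v w * qprod w v) * branch v w.
  rewrite (N_edge (vertex_notin1 vV) vw) (N_edge (vertex_notin1 wV) wv).
  ring.
rewrite -(pmulr_rgt0 _ Q0) EN; apply: ltr_wpDl.
  by apply: mulr_ge0 => //; apply: le_trans q1.
by rewrite -mulNr; apply: mulr_gt0; rewrite ?oppr_gt0.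
Qed.

Lemma a_ge1 v : v \in vertices T -> 1 <= a_ v.
Proof.
move=> vV; rewrite /a_; case: pickP => // e eD.
have [[e' e'E <-] _] := newton_dead_end_max newtonT vV eD.
exact: newton_Eplus_ge1 e'E.
Qed.

Lemma dead_end_arrow v e : v \in vertices T -> e \in dead_ends_at v ->
  exists z, [/\ adj v z, z \in arrows0 T & e = [set v; z]].
Proof.
move=> vV; rewrite inE => /andP[/andP[eE /existsP[z /andP[z0 ze]]] ve].
have /edge_nbr[w vw Ee] : incident e v by rewrite /incident eE.
have zw : z = w.
  move: ze; rewrite Ee !inE => /orP[/eqP zv|/eqP//].
  by move: vV z0; rewrite zv !inE => /negPf->.
by exists z; rewrite z0 zw.
Qed.

Lemma arrow_dead_end v z : adj v z -> z \in arrows0 T -> [set v; z] \in dead_ends_at v.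
Proof.
move=> vz z0; rewrite inE set21 andbT; apply/andP; split; first exact: vz.
by apply/existsP; exists z; rewrite z0 set22.
Qed.

Lemma a_prod v : v \in vertices T -> \prod_(z | adj v z && (z \in arrows0 T)) qn v z = a_ v.
Proof.
move=> vV; rewrite /a_; case: pickP => [e eD|noD]; last first.
  by rewrite big_pred0 // => z; apply/negP => /andP[vz z0]; have := noD [set v; z];
    rewrite /= arrow_dead_end.
have [z [vz z0 Ee]] := dead_end_arrow vV eD.
rewrite (big_pred1 z) => [|w]; first by rewrite Ee.
apply/idP/eqP => [/andP[vw w0]|->]; last by rewrite /= vz.
have /card_le1_eqP D1 := newton_dead_end newtonT vV.
by apply: (@set2_inj _ v); rewrite -Ee; apply: D1 => //; apply: arrow_dead_end.
Qed.

Section Complete.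
Hypothesis completeT : minimally_complete T.

Lemma dicritical_vertex w : w \in dicritical T -> w \in vertices T.
Proof. by rewrite inE => /andP[]. Qed.

Lemma NN_vertex w : w \in NN T -> w \in vertices T.
Proof. by rewrite inE => /andP[]. Qed.

Lemma vertex_cases v : v \in vertices T -> (v \in NN T) = (v \notin dicritical T).
Proof.
move=> vV; rewrite [in LHS]inE [in RHS]inE vV /= lt_def.
by rewrite (mc_N_ge0 completeT vV) andbT.
Qed.

(** If [v] were a child of [w], [N_parent_gt0] would give [0 < N_ w]. *)
Lemma dicritical_nbr v w : w \in dicritical T -> v \in vertices T -> adj v w -> child v w.
Proof.
move=> wD vV vw; have := child_or_parent vw; case/orP=> // cwv.
have := N_parent_gt0 (dicritical_vertex wD) vV cwv (mc_N_ge0 completeT vV).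
by move: wD; rewrite inE => /andP[_ /eqP->].
Qed.

(** Both neighbours would be the parent of [w]: dicritical vertices are leaves of
    the tree of vertices. *)
Lemma dicritical_nbr_uniq v v' w : w \in dicritical T ->
  v \in vertices T -> v' \in vertices T -> adj v w -> adj v' w -> v = v'.
Proof.
by move=> wD vV vV' vw vw'; apply: (@parent_uniq _ _ _ w); apply: dicritical_nbr.
Qed.

Lemma NN_nbr v z : v \in NN T -> adj v z -> z \notin arrows1 T.
Proof.
move=> vN vz; apply/negP => z1; have [w wD zw] := mc_arrow1 completeT z1.
have zv : adj z v by rewrite adj_sym.
move: vN; rewrite (arrow_nbr (arrows1P z1) zv zw) => wN.
by move: (wN); rewrite vertex_cases ?wD ?NN_vertex.
Qed.

(** Connectedness of [NN]: an inner cell of the path has two distinct neighbouring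
    vertices, hence is not dicritical. *)
Lemma NN_toward v c : v \in NN T -> c \in NN T -> c != v -> toward v c \in NN T.
Proof.
move=> vN cN cv; have [vz zvc] := towardP cv; set z := toward v c in vz zvc *.
have [<- // | cz] := eqVneq c z; have [zw wzc] := towardP cz.
set w := toward z c in zw wzc *.
have vw : v != w by apply: contraTneq wzc => <-; apply: gamma_notin.
have zv : adj z v by rewrite adj_sym.
rewrite vertex_cases ?(vertex2 zv zw vw) //; apply/negP => zD.
have wV : w \in vertices T.
  have [<- | cw] := eqVneq c w; first exact: NN_vertex.
  have [wy yc] := towardP cw; apply: (vertex2 (x := z)) wy _; first by rewrite adj_sym.
  by apply: contraTneq yc => <-; apply: gamma_notin.
have wz : adj w z by rewrite adj_sym.
by rewrite (dicritical_nbr_uniq zD (NN_vertex vN) wV vz wz) eqxx in vw.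
Qed.

Lemma child_arrow v z : z \in arrows T -> adj v z -> child v z.
Proof.
move=> za vz; case/orP: (child_or_parent vz) => // /andP[_].
by rewrite beyond_arrow // => /eqP Er; move: za; rewrite -Er !inE eqxx.
Qed.

(** The dead end at [w] carries the largest decoration, and at most one child edge
    has a decoration greater than [1]. *)
Lemma dicritical_arrow w z : w \in dicritical T -> adj w z -> z \in arrows1 T -> qn w z = 1.
Proof.
move=> wD wz z1; have wV := dicritical_vertex wD.
have cwz := child_arrow (arrows1P z1) wz.
have [e eD] := mc_dicritical completeT wD; have [y [wy y0 Ee]] := dead_end_arrow wV eD.
have [_ /(_ _ (child_Eplus cwz)) le_e] := newton_dead_end_max newtonT wV eD.
apply/eqP; rewrite eq_le (qn_child_ge1 wV cwz) andbT leNgt; apply/negP => gt1.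
have cwy : child w y by apply: child_arrow => //; move: y0; rewrite inE => /andP[].
have /card_le1_eqP D1 := newton_Eplus_gt1 newtonT wV.
have : [set w; z] = [set w; y].
  apply: D1; rewrite inE child_Eplus //=.
  by rewrite -Ee; apply: lt_le_trans le_e.
by move/set2_inj=> zy; move: z1; rewrite zy inE y0.
Qed.

(** All neighbours of [w] except [v] are arrows, and the edges to the (1)-arrows have
    decoration [1] near [w], so each of these arrows contributes [qprod w v] to
    [branch v w]; then [N_ w = 0] determines the opposite branch sum. *)
Lemma dicritical_branch v w : w \in dicritical T -> v \in vertices T -> adj v w ->
  [/\ (0 < degree w)%N, branch v w = qprod w v * (degree w)%:Z
    & branch w v = - qn w v * (degree w)%:Z].
Proof.
move=> wD vV vw; have cvw := dicritical_nbr wD vV vw.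
have wV := dicritical_vertex wD; have wv : adj w v by rewrite adj_sym.
have Q0 := qprod_parent_gt0 wV cvw.
have A0 : 0 < branch v w by apply: (branch_child cvw).2; rewrite inE negb_and -in_setC wV.
have EA : branch v w = qprod w v * (degree w)%:Z.
  rewrite branchE ?vertex_notin1 //.
  have brz z : adj w z && (z != v) -> branch w z = (z \in arrows1 T)%:R.
    case/andP=> wz zv; apply: branch_arrow => //.
    apply: contraNT zv => za; have zV : z \in vertices T by rewrite inE.
    by apply/eqP; apply: dicritical_nbr_uniq wD _ _ _ _; rewrite // adj_sym.
  rewrite (bigID (mem (arrows1 T))) /= addrC big1 ?add0r => [|z /andP[wz z1]]; last first.
    by rewrite brz // (negPf z1) mulr0.
  rewrite (eq_bigr (fun=> qprod w v)) => [|z /andP[wz z1]]; last first.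
    have zz : adj w z && (z != v) by [].
    rewrite brz // z1 mulr1 /qprod [RHS](bigD1 z) //= dicritical_arrow ?mul1r //.
      by apply: eq_bigl => y; rewrite andbA.
    by case/andP: wz.
  rewrite -natz mulr_natr /degree -sumr_const; apply: eq_bigl => z; rewrite inE.
  case: eqP => [->|_]; last by rewrite andbT andbC.
  by rewrite andbF (negPf (vertex_notin1 vV)).
have D0 : (0 < degree w)%N.
  by move: A0; rewrite EA pmulr_rgt0.
split=> //; move: wD; rewrite inE => /andP[_].
rewrite (N_edge (vertex_notin1 wV) wv) EA mulrCA -mulrDr.
by rewrite mulf_eq0 gt_eqF //= addr_eq0 mulNr => /eqP.
Qed.

End Complete.
End NewtonTree.

(** * Characteristic numbers along an edge *)

Section Characteristic.
Variable T : decorated_tree.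
Hypothesis newtonT : abstract_newton_tree T.
Hypothesis completeT : minimally_complete T.
Implicit Types (x y z c u v w : T) (e : {set T}).
Local Notation adj := (@adj T).
Local Notation qprod := (@qprod T).

Lemma PT_edge u v : ((u, [set u; v]) \in PT T) = [&& u \in NN T, v \in NN T & adj u v].
Proof.
rewrite inE /= set21 andbT inE -[_ \in edges T]/(adj u v) andbC andbA; congr (_ && _).
apply/subsetP/andP => [sN|[uN vN] z /set2P[]-> //].
by rewrite !sN ?set21 ?set22.
Qed.

Lemma PT_nbr u e : (u, e) \in PT T ->
  exists v, [/\ e = [set u; v], u \in NN T, v \in NN T & adj u v].
Proof.
move=> ueP; have: incident e u.
  by move: ueP; rewrite !inE => /andP[/andP[eE _] ue]; rewrite /incident eE.
case/edge_nbr => v uv Ee; exists v; move: ueP; rewrite Ee PT_edge => /and3P[uN vN _].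
by split.
Qed.

Lemma NN_N_gt0 v : v \in NN T -> 0 < N_ v.
Proof. by rewrite inE => /andP[]. Qed.

(** The vertices adjacent to [v] beyond the edge from [u]; for [u] and [v] in [NN]
    they fall into those in [NN] and the dicritical ones ([other_nbrsE]). *)
Definition other_nbrs v u : {set T} := [set y in vertices T | adj v y && (y != u)].

(** The common role played by [c_] at a neighbour in [NN] and by [degree] at a
    dicritical neighbour. *)
Definition branch_char v y : rat :=
  if y \in NN T then c_ (v, [set v; y]) else (degree y)%:R.

Lemma other_nbrsE v u : u \in NN T -> v \in NN T ->
  other_nbrs v u = (NNadj v :\ u) :|: dicriticals_at v.
Proof.
move=> uN vN; apply/setP => y; rewrite in_setU in_setD1.
rewrite [LHS]inE [y \in NNadj v]inE [y \in dicriticals_at v]inE.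
have [yV | yV] := boolP (y \in vertices T); last first.
  have yN : y \notin NN T by apply: contra yV; apply: NN_vertex.
  have yD : y \notin dicritical T by apply: contra yV; apply: dicritical_vertex.
  by rewrite (negPf yN) (negPf yD) andbF.
rewrite vertex_cases //; have [yD | yD] /= := boolP (y \in dicritical T).
  rewrite andbF /=; case: (adj v y) => //=.
  by apply: contraTneq yD => ->; rewrite -vertex_cases ?NN_vertex.
by rewrite orbF andbC.
Qed.

Lemma other_nbrs_disjoint v u : [disjoint NNadj v :\ u & dicriticals_at v].
Proof.
rewrite -setI_eq0; apply/eqP/setP => y.
rewrite in_setI in_setD1 [y \in NNadj v]inE [y \in dicriticals_at v]inE in_set0.
apply/negP => /andP[/and3P[_ yN _] /andP[yD _]].
by move: (yN); rewrite vertex_cases ?yD ?NN_vertex.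
Qed.

Lemma sum_other_nbrs (F : T -> rat) v u : u \in NN T -> v \in NN T ->
  \sum_(y in other_nbrs v u) F y =
  \sum_(y in NNadj v :\ u) F y + \sum_(y in dicriticals_at v) F y.
Proof.
move=> uN vN; rewrite other_nbrsE // -bigU /=; last exact: other_nbrs_disjoint.
by apply: eq_bigl => y; rewrite inE.
Qed.

Lemma branch_charN v u y : y \in NNadj v :\ u -> branch_char v y = c_ (v, [set v; y]).
Proof. by rewrite in_setD1 [_ \in NNadj v]inE /branch_char => /and3P[_ -> _]. Qed.

Lemma branch_charD v y : y \in dicriticals_at v -> branch_char v y = (degree y)%:R.
Proof.
rewrite inE => /andP[yD _]; rewrite /branch_char vertex_cases ?yD //.
exact: dicritical_vertex.
Qed.

(** ** The numbers [d_] and [c_] *)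

Lemma d_max v (z : rat) : v \in NN T ->
  (N_ v)%:~R / z \is a Num.int ->
  (forall y, y \in dicriticals_at v -> (degree y)%:R / z \is a Num.int) ->
  (d_ v)%:~R / z \is a (@Num.int rat).
Proof.
move=> vN Nz Dz; rewrite /d_; case: ifP => // _.
exact: biggcdn_dvd_int.
Qed.

Lemma d_gt0 v : v \in NN T -> 0 < d_ v.
Proof.
move=> vN; rewrite /d_ /node vN /=; case: eqVneq => [_|]; first exact: NN_N_gt0.
case/set0Pn => y yD; rewrite /= ltz_nat; apply: (@dvdn_gt0 _ (degree y)).
  move: yD; rewrite inE => /andP[yD vy].
  by have [] := dicritical_branch newtonT completeT yD (NN_vertex vN) vy.
exact: (biggcdn_inf y).
Qed.

Lemma d_dvd_degree v y : v \in NN T -> y \in dicriticals_at v ->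
  (degree y)%:R / (d_ v)%:~R \is a (@Num.int rat).
Proof.
move=> vN yD; rewrite /d_ /node vN /=; case: eqVneq => [D0|_]; first by rewrite D0 inE in yD.
rewrite /=; set g := \big[_/_]_(_ in _) _.
have /dvdnP[k ->] : (g %| degree y)%N by apply: (biggcdn_inf y).
have [-> | g0] := posnP g; first by rewrite muln0 mul0r rpred0.
by rewrite natrM mulfK ?rpred_nat // pnatr_eq0 -lt0n.
Qed.

Lemma d_N v : dicriticals_at v = set0 -> d_ v = N_ v.
Proof. by move=> D0; rewrite /d_ /node D0 eqxx andbF. Qed.

(** This covers both cases of the definition of [c_]: if [u] is the only neighbour
    of [v] in [NN], the family of the [y] is empty and [g] is [d_ v]. *)
Lemma char_gcd u v : u \in NN T -> v \in NN T -> adj u v ->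
  exists g : rat, [/\ c_ (u, [set u; v]) = g / (a_ v)%:~R, 0 < g,
    (d_ v)%:~R / g \is a Num.int,
    forall y, y \in NNadj v :\ u -> c_ (v, [set v; y]) / g \is a Num.int
  & forall z : rat, (d_ v)%:~R / z \is a Num.int ->
      (forall y, y \in NNadj v :\ u -> c_ (v, [set v; y]) / z \is a Num.int) ->
      g / z \is a Num.int].
Proof.
move=> uN vN uv; have d0 : 0 < (d_ v)%:~R :> rat by rewrite ltr0z d_gt0.
rewrite char_numE; last by rewrite PT_edge uN vN uv.
have uA : u \in NNadj v by rewrite inE uN adj_sym uv.
case: eqP => [eps1 | _].
  exists (d_ v)%:~R; split=> //; first by rewrite divff ?gt_eqF ?rpred1.
  suff -> : NNadj v :\ u = set0 by move=> y; rewrite inE.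
  by apply/eqP; rewrite -cards_eq0; have := cardsD1 u (NNadj v);
    rewrite -/(epsilon v) eps1 uA add1n => -[<-].
set s := (_ :: _); exists (ratgcd s); have := ratgcd_ge0 s.
have [k Ek] := ratgcd_dvd (mem_head _ _ : (d_ v)%:~R \in s).
have g_neq0 : ratgcd s != 0.
  by apply: contraTneq d0 => g0; rewrite Ek g0 mul0rz ltxx.
have dvd (x : rat) : x \in s -> x / ratgcd s \is a Num.int.
  by move=> /ratgcd_dvd[l El]; rewrite {1}El -mulrzl mulfK // rpred_int.
have cs y : y \in NNadj v :\ u -> c_ (v, [set v; y]) \in s.
  by move=> yA; rewrite inE; apply/orP; right; apply: map_f; rewrite mem_enum.
rewrite le_eqVlt eq_sym (negPf g_neq0) /= => g0; split=> //.
- exact/dvd/mem_head.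
- by move=> y /cs/dvd.
move=> z dz cz; apply: ratgcd_greatest => x; rewrite inE => /orP[/eqP-> //|].
by case/mapP=> y; rewrite mem_enum => yA ->; apply: cz.
Qed.

(** ** Cells beyond an edge of [NN] *)

Lemma mem_NNpair u v x : adj u v ->
  (x \in NNpair (u, [set u; v])) = (x \in NN T) && (v \in gamma u x).
Proof. by move=> uv; rewrite inE /= mem_gamma_edges. Qed.

Lemma DeltaS_step u v : u \in NN T -> v \in NN T -> adj u v ->
  DeltaS (NNpair (u, [set u; v])) =
  Delta v + \sum_(y in NNadj v :\ u) DeltaS (NNpair (v, [set v; y])).
Proof.
move=> uN vN uv; rewrite /DeltaS (bigD1 v) ?mem_NNpair ?vN ?gamma_last //=; congr (_ + _).
rewrite (partition_big (toward v) (mem (NNadj v :\ u))) /=; last first.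
  move=> x /andP[]; rewrite mem_NNpair // => /andP[xN vux] xv.
  have [vy yvx] := towardP xv.
  have := beyondP x uv vy; rewrite vux xv eqxx /= => /esym/andP[yu _].
  by rewrite in_setD1 yu inE vy NN_toward.
apply: eq_bigr => y; rewrite in_setD1 inE => /and3P[yu yN vy]; apply: eq_bigl => x.
rewrite !mem_NNpair // -!andbA; congr (_ && _).
by rewrite (beyondP x uv vy) yu.
Qed.

(** ** Divisibility and nonnegativity *)

Definition edge_invariant u v : Prop :=
  [/\ 0 < c_ (u, [set u; v]),
      (branch u v)%:~R / c_ (u, [set u; v]) \is a Num.int,
      (branch v u)%:~R / c_ (u, [set u; v]) \is a Num.int
    & 0 <= eta (u, [set u; v])].

Section Step.
Variables u v : T.
Hypotheses (uN : u \in NN T) (vN : v \in NN T) (uv : adj u v).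
Hypothesis IH : forall y, y \in NNadj v :\ u -> edge_invariant v y.

Let vV : v \in vertices T := NN_vertex vN.
Let v1 : v \notin arrows1 T := vertex_notin1 vV.
Let vu : adj v u. Proof. by rewrite adj_sym. Qed.

Lemma other_nbr_dvd y : y \in other_nbrs v u ->
  [/\ 0 < branch_char v y, (branch v y)%:~R / branch_char v y \is a Num.int,
      (branch y v)%:~R / branch_char v y \is a Num.int
    & (N_ v)%:~R / branch_char v y \is a Num.int].
Proof.
move=> yI; have: adj v y by move: yI; rewrite inE => /and3P[].
move=> vy; rewrite (N_edge v1 vy) intrD !intrM mulrDl -!mulrA.
suff [x0 xb xb'] : [/\ 0 < branch_char v y, (branch v y)%:~R / branch_char v y \is a Num.int &
      (branch y v)%:~R / branch_char v y \is a Num.int].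
  by split=> //; rewrite rpredD // rpredM // rpred_int.
move: yI; rewrite other_nbrsE // inE => /orP[yA|yD].
  by rewrite (branch_charN yA); case: (IH yA).
rewrite branch_charD //; move: yD; rewrite inE => /andP[yD _].
have [d0 -> ->] := dicritical_branch newtonT completeT yD vV vy.
have d0' : (degree y)%:R != 0 :> rat by rewrite pnatr_eq0 -lt0n.
by rewrite ltr0n d0 !intrM !mulfK // !rpred_int.
Qed.

(** Since [d_ v] is the gcd of the degrees or, without dicritical neighbours, [N_ v],
    the number [g] is a gcd of the [branch_char v y]. The condition on [N_ v] in the
    last clause covers the case in which there is no [y] and [g] is [N_ v]. *)
Lemma char_branch_gcd : exists g : rat, [/\ c_ (u, [set u; v]) = g / (a_ v)%:~R, 0 < g,
    forall y, y \in other_nbrs v u -> branch_char v y / g \is a Num.int,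
    (other_nbrs v u = set0 -> (N_ v)%:~R / g \is a Num.int)
  & forall z : rat, (N_ v)%:~R / z \is a Num.int ->
      (forall y, y \in other_nbrs v u -> branch_char v y / z \is a Num.int) ->
      g / z \is a Num.int].
Proof.
have [g [Ec g0 dg cg gmax]] := char_gcd uN vN uv; exists g; split=> //.
- move=> y; rewrite other_nbrsE // inE => /orP[yA|yD]; first by rewrite (branch_charN yA) cg.
  rewrite branch_charD //; apply: ratdvd_trans dg; last exact: d_dvd_degree.
  by rewrite intr_eq0 gt_eqF ?d_gt0.
- move=> I0; rewrite -d_N //; apply/eqP; rewrite -subset0 -I0 other_nbrsE //.
  exact: subsetUr.
move=> z Nz xz; apply: gmax => [|y yA]; last first.
  by rewrite -(branch_charN yA); apply: xz; rewrite other_nbrsE // inE yA.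
apply: d_max => // y yD; rewrite -(branch_charD yD).
by apply: xz; rewrite other_nbrsE // inE yD orbT.
Qed.

Lemma branch_arrow0 y : adj v y -> y \notin vertices T -> branch v y = 0.
Proof.
move=> vy; rewrite inE negbK => ya; rewrite branch_arrow //.
by rewrite (negPf (NN_nbr completeT vN vy)).
Qed.

(** The neighbours of [v] are vertices or carry the dead end, whose decoration is
    the factor [a_ v]. Taking [z = u] gives the product over all edges
    other than [u v]. *)
Lemma qprod_other_nbrs z : z \in vertices T ->
  \prod_(w | adj v w && ((w != z) && (w != u))) qn v w =
  a_ v * \prod_(w in other_nbrs v u :\ z) qn v w.
Proof.
move=> zV; rewrite -a_prod // (bigID (fun w => w \in arrows0 T)) /=; congr (_ * _).
  apply: eq_bigl => w; case w0: (w \in arrows0 T); rewrite ?andbF // !andbT.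
  have wV := arrow0_notin w0.
  have -> : w != z by apply: contraNneq wV => ->.
  have -> : w != u by apply: contraNneq wV => ->; apply: NN_vertex.
  by rewrite !andbT.
apply: eq_bigl => w; rewrite in_setD1 [w \in other_nbrs v u]inE.
case vw: (adj v w); rewrite ?andbF //=.
have := cell_cases w; rewrite (negPf (NN_nbr completeT vN vw)) orbF.
have [wV _ | wV /= ->] := boolP (w \in vertices T); last by rewrite !andbF.
by rewrite (contraL (@arrow0_notin _ w)) // andbT.
Qed.

(** The terms of [Delta v] recombine because [r_ v] is the number of neighbouring
    vertices of [v] other than [u]. *)
Lemma eta_step (g : rat) : c_ (u, [set u; v]) = g / (a_ v)%:~R ->
  eta (u, [set u; v]) - \sum_(y in NNadj v :\ u) eta (v, [set v; y]) =
  \sum_(y in other_nbrs v u) ((N_ v)%:~R - branch_char v y) - ((N_ v)%:~R - g) / (a_ v)%:~R.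
Proof.
move=> Ec; rewrite /eta DeltaS_step // Ec sum_other_nbrs //.
have Er : r_ v = (#|NNadj v :\ u| + #|dicriticals_at v|)%:Z.
  rewrite /r_; set V := [set w in vertices T | adj v w].
  have uV : u \in V by rewrite inE NN_vertex.
  have -> : (#|NNadj v :\ u| + #|dicriticals_at v|)%N = #|V :\ u|.
    rewrite -cardsUI; have := other_nbrs_disjoint v u; rewrite -setI_eq0 => /eqP->.
    rewrite cards0 addn0 -other_nbrsE //; apply: eq_card => y.
    by rewrite !inE andbA andbC.
  by rewrite (cardsD1 u) uV PoszD addKr.
set A := NNadj v :\ u in Er *; set D := dicriticals_at v in Er *.
have -> : \sum_(y in A) ((N_ v)%:~R - branch_char v y) =
    (N_ v)%:~R * #|A|%:R - \sum_(y in A) c_ (v, [set v; y]) :> rat.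
  rewrite sumrB sumr_const mulr_natr; congr (_ - _).
  by apply: eq_bigr => y yA; rewrite (branch_charN yA).
have -> : \sum_(y in D) ((N_ v)%:~R - branch_char v y) =
    (N_ v)%:~R * #|D|%:R - \sum_(y in D) (degree y)%:R :> rat.
  rewrite sumrB sumr_const mulr_natr; congr (_ - _).
  by apply: eq_bigr => y yD; rewrite (branch_charD yD).
have -> : \sum_(y in A) (DeltaS (NNpair (v, [set v; y])) - (1 - c_ (v, [set v; y]))) =
    \sum_(y in A) DeltaS (NNpair (v, [set v; y]))
      - (#|A|%:R - \sum_(y in A) c_ (v, [set v; y])) :> rat.
  by rewrite !sumrB sumr_const.
rewrite /Delta Er sumrB sumr_const -/D.
have -> : ((#|A| + #|D|)%:Z - 1)%:~R = #|A|%:R + #|D|%:R - 1 :> rat.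
  by rewrite intrB PoszD intrD.
rewrite intrB; move: (\sum_(y in A) _) (\sum_(y in A) _) (\sum_(y in D) _) => x y z.
move: #|A|%:R #|D|%:R (N_ v)%:~R => n m N; move: (a_ v)%:~R => a; ring.
Qed.

(** The inductive step; the comparison with the next edges comes from the same
    inequality as the nonnegativity of [eta]. *)
Lemma invariant_step : edge_invariant u v /\
  forall y, y \in NNadj v :\ u ->
    c_ (u, [set u; v]) <= c_ (v, [set v; y]) /\
    eta (v, [set v; y]) <= eta (u, [set u; v]).
Proof.
have [g [Ec g0 xg Ng gmax]] := char_branch_gcd.
have N0 : 0 < (N_ v)%:~R :> rat by rewrite ltr0z NN_N_gt0.
have a1 : 1 <= (a_ v)%:~R :> rat by rewrite ler1z a_ge1.
have a0 : 0 < (a_ v)%:~R :> rat by apply: lt_le_trans a1.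
have dvd_c (x : rat) : x * (a_ v)%:~R / g \is a Num.int ->
    x / c_ (u, [set u; v]) \is a Num.int.
  by rewrite Ec invf_div mulrA.
have dvd_c' (x : rat) : x / g \is a Num.int -> x / c_ (u, [set u; v]) \is a Num.int.
  by move=> xg'; apply: dvd_c; rewrite mulrAC rpredM // rpred_int.
have bg z : adj v z -> z != u -> (branch v z)%:~R / g \is a Num.int.
  move=> vz zu; have [zV | zV] := boolP (z \in vertices T); last first.
    by rewrite branch_arrow0 // mul0r rpred0.
  have zI : z \in other_nbrs v u by rewrite inE zV vz.
  have [x0 xb _ _] := other_nbr_dvd zI; apply: ratdvd_trans xb (xg z zI).
  by rewrite gt_eqF.
have buv : (branch u v)%:~R / g \is a Num.int.
  rewrite branchE // rmorph_sum /= mulr_suml rpred_sum // => z /andP[vz zu].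
  by rewrite intrM -mulrA rpredM ?rpred_int // bg.
have bvu : (branch v u)%:~R * (a_ v)%:~R / g \is a Num.int.
  have [I0 | I_neq0] := eqVneq (other_nbrs v u) set0.
    (* no arrow lies beyond [v], so that [N_ v] is exactly [a_ v * branch v u] *)
    suff <- : (N_ v)%:~R = (branch v u)%:~R * (a_ v)%:~R :> rat by apply: Ng.
    have buv0 : branch u v = 0.
      rewrite branchE // big1 // => z /andP[vz zu].
      rewrite branch_arrow0 ?mulr0 //; apply/negP => zV.
      by have := in_set0 z; rewrite -I0 inE zV vz zu.
    rewrite -intrM (N_edge v1 vu) buv0 mulr0 addr0.
    rewrite mulrC /qprod; congr ((_ * _)%:~R).
    under eq_bigl => w do rewrite -[w != u]andbb.
    by rewrite qprod_other_nbrs ?NN_vertex // I0 set0D big_set0 mulr1.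
  have cop : {in other_nbrs v u &, forall x y, x != y -> coprimez (qn v x) (qn v y)}.
    move=> x y; rewrite !inE => /and3P[_ vx _] /and3P[_ vy _] xy.
    by apply: (newton_coprime newtonT); rewrite ?incident_nbr // edge2_inj.
  pose I (m : int) : Prop := m%:~R * ((branch v u)%:~R * (a_ v)%:~R) / g \is a Num.int.
  suff : I 1 by rewrite /I mul1r.
  apply: (cofactors_ideal _ _ I_neq0 cop); rewrite /I.
  - by move=> m n Im In; rewrite intrD !mulrDl rpredD.
  - by move=> m n /(rpredM (rpred_int _ m)); rewrite intrM !mulrA.
  move=> z zI; have [x0 _ xb _] := other_nbr_dvd zI.
  have [zV vz zu] : [/\ z \in vertices T, adj v z & z != u].
    by move: zI; rewrite inE => /and3P[].
  have zv : adj z v by rewrite adj_sym.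
  have := ratdvd_trans (lt0r_neq0 x0) xb (xg z zI).
  (* in the expansion of [branch z v], all terms but that of [u] are multiples
     of [g] *)
  rewrite branchE // (bigD1 u) /= ?vu 1?eq_sym // intrD mulrDl.
  set R := (\sum_(_ | _) _); have Rg : R%:~R / g \is a Num.int.
    rewrite rmorph_sum /= mulr_suml rpred_sum // => y /andP[/andP[vy yz] yu].
    by rewrite intrM -mulrA rpredM ?rpred_int // bg.
  rewrite rpredDr // qprod_other_nbrs // !intrM.
  rewrite -[_ * _ * (branch v u)%:~R]mulrA [(a_ v)%:~R * _]mulrC.
  by rewrite -[_ * _ * (a_ v)%:~R]mulrA.
have eta_ge : \sum_(y in NNadj v :\ u) eta (v, [set v; y]) <= eta (u, [set u; v]).
  rewrite -subr_ge0 (eta_step Ec) subr_ge0 ler_pdivrMr //.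
  have le_gd : (N_ v)%:~R - g <= \sum_(y in other_nbrs v u) ((N_ v)%:~R - branch_char v y).
    apply: gcd_defect => // [y yI|z _]; last exact: gmax.
    by have [] := other_nbr_dvd yI.
  apply: le_trans le_gd _; rewrite ler_peMr // sumr_ge0 // => y yI.
  by have [x0 _ _ xN] := other_nbr_dvd yI; rewrite subr_ge0 ratdvd_le.
have eta0 y : y \in NNadj v :\ u -> 0 <= eta (v, [set v; y]) by case/IH.
split; first split.
- by rewrite Ec divr_gt0.
- exact: dvd_c'.
- exact: dvd_c.
- by apply: le_trans eta_ge; apply: sumr_ge0.
move=> y yA; split; last first.
  apply: le_trans eta_ge; rewrite (bigD1 y) //= lerDl sumr_ge0 // => z /andP[zA _].
  exact: eta0.
have [c0 _ _ _] := IH yA; have yI : y \in other_nbrs v u by rewrite other_nbrsE // inE yA.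
have le_g : g <= c_ (v, [set v; y]) by apply: ratdvd_le => //; rewrite -(branch_charN yA) xg.
by rewrite Ec ler_pdivrMr //; apply: le_trans le_g _; rewrite ler_peMr // ltW.
Qed.

End Step.

Lemma invariant_edge u v : u \in NN T -> v \in NN T -> adj u v -> edge_invariant u v.
Proof.
move=> uN vN uv; move: u v uv uN vN; apply: oriented_edge_ind => u v uv IH uN vN.
apply: (invariant_step uN vN uv _).1 => y; rewrite in_setD1 inE => /and3P[yu yN vy].
exact: IH.
Qed.

Definition dominated (p' p : T * {set T}) : Prop :=
  [/\ NNpair p' \subset NNpair p, c_ p <= c_ p' & eta p' <= eta p].

Lemma dominated_step u v y : u \in NN T -> v \in NN T -> y \in NN T ->
  adj u v -> adj v y -> y != u -> dominated (v, [set v; y]) (u, [set u; v]).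
Proof.
move=> uN vN yN uv vy yu; split; first exact: proper_sub (NNpair_step vN uv vy yu).
all: have yA : y \in NNadj v :\ u by rewrite in_setD1 yu inE yN.
all: have IH z : z \in NNadj v :\ u -> edge_invariant v z
  by rewrite in_setD1 inE => /and3P[_ zN vz]; apply: invariant_edge.
all: by have [] := (invariant_step uN vN uv IH).2 y yA.
Qed.

Lemma dominated_trans p1 p2 p3 : dominated p1 p2 -> dominated p2 p3 -> dominated p1 p3.
Proof.
case=> s12 c12 e12 [s23 c23 e23]; split; first exact: subset_trans s23.
  exact: le_trans c12.
exact: le_trans e23.
Qed.

Lemma dominated_chain u v u' v' : u \in NN T -> v \in NN T -> adj u v ->
  u' \in NN T -> v' \in NN T -> adj u' v' ->
  v \in gamma u u' -> v' \notin gamma u u' ->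
  dominated (u', [set u'; v']) (u, [set u; v]).
Proof.
move=> uN vN uv u'N v'N u'v'; move: u v uv uN vN.
apply: oriented_edge_ind => u v uv IH uN vN vuu' v'uu'.
have [Eu' | u'v] := eqVneq u' v.
  rewrite Eu' in u'v' *; apply: dominated_step => //.
  by apply: contraNneq v'uu' => ->; rewrite mem_head.
have [vz zvu'] := towardP u'v; set z := toward v u' in vz zvu'.
have zN : z \in NN T by apply: NN_toward.
have zu : z != u.
  by have := beyondP u' uv vz; rewrite vuu' u'v eqxx /= => /esym/andP[].
apply: dominated_trans (dominated_step uN vN zN uv vz zu); apply: IH => //.
by apply: contra v'uu' => v'v; rewrite (gamma_step uv vuu') in_cons v'v orbT.
Qed.

Lemma Ple_dominated p' p : p \in PT T -> p' \in PT T -> Ple p' p -> dominated p' p.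
Proof.
case: p p' => u e [u' e'] ueP ueP' /orP[/eqP-> | ]; first by split.
have [v [-> uN vN uv]] := PT_nbr ueP; have [v' [-> uN' vN' uv']] := PT_nbr ueP'.
case/andP=> /= eg e'g; apply: dominated_chain => //.
  by rewrite gamma_sym; apply: gamma_edges_cell eg _; rewrite set22.
by rewrite gamma_sym -mem_gamma_edges.
Qed.

End Characteristic.

Theorem lemma4p9 (T : decorated_tree)
    (newtonT : abstract_newton_tree T) (completeT : minimally_complete T)
    (u : T) (e : {set T}) (u' : T) (e' : {set T})
    (ueP : (u, e) \in PT T) (ueP' : (u', e') \in PT T)
    (le_ue : Ple (u', e') (u, e)) :
  [/\ NNpair (u', e') \subset NNpair (u, e),
      c_ (u, e) <= c_ (u', e') /\ eta (u', e') <= eta (u, e),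
      DeltaS (NNpair (u, e)) - DeltaS (NNpair (u', e')) =
        (c_ (u', e') - c_ (u, e)) + (eta (u, e) - eta (u', e'))
    & DeltaS (NNpair (u', e')) <= DeltaS (NNpair (u, e)) /\
      (DeltaS (NNpair (u, e)) = DeltaS (NNpair (u', e')) <->
       c_ (u, e) = c_ (u', e') /\ eta (u, e) = eta (u', e'))].
Proof.
have [sub le_c le_eta] := Ple_dominated newtonT completeT ueP ueP' le_ue.
have E p : DeltaS (NNpair p) = eta p + 1 - c_ p by rewrite /eta; ring.
split=> //; first by rewrite !E; ring.
rewrite !E; split; first by lra.
by split=> [|[-> ->//]]; split; lra.
Qed.
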